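(* Let $H=(V,E)$ be a non-separable hypergraph with at least two edges of cardinality greater than $1$. Let $G=\mathcal{G}(H)$ be its incidence graph and $x$ a cut vertex of $G$. Then $x\in E$ and $x$ is a weak cut edge of $H$.
   Context: A hypergraph $H=(V,E)$ consists of a nonempty finite vertex set $V$, a finite edge set $E$, and an incidence function $\psi:E\to 2^V$; edges are identified with their vertex sets (parallel edges allowed). Two distinct vertices are adjacent via $e$ if both lie in $e$; a walk is a sequence $v_0e_1v_1\dots e_kv_k$ with $v_{i-1},v_i$ adjacent via $e_i$; $H$ is connected if any two distinct vertices are joined by a walk. For an equivalence class $V'$ of ''joined by a walk'', the connected component is $(V',\{f\in E:\emptyset\ne f\subseteq V'\})$; $\omega(H)$ is the number of components. $H-e=(V,E\setminus\{e\})$; $e$ is a cut edge if $\omega(H-e)>\omega(H)$; a cut edge is strong if $\omega(H-e)=\omega(H)+|e|-1$ and weak otherwise. A hypersubgraph is $(V',E')$ with $V'\subseteq V$, $E'\subseteq E$. A vertex $v$ is a separating vertex of $H$ if there are two connected hypersubgraphs $H_1,H_2$, each with at least one edge, with $E(H_1)\cap E(H_2)=\emptyset$, $V=V(H_1)\cup V(H_2)$, $E=E(H_1)\cup E(H_2)$, and $V(H_1)\cap V(H_2)=\{v\}$. $H$ is non-separable if it is connected, has no empty edges and no separating vertices. The incidence graph $\mathcal{G}(H)$ is the bipartite graph with vertex set $V\cup E$ and edge set $\{ve:v\in e\}$; a cut vertex of a graph is a vertex whose deletion increases the number of connected components. *)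

(* Defs.v *)
From mathcomp Require Import all_boot.
From mathcomp Require Import boolp.

Set Implicit Arguments.
Unset Strict Implicit.
Unset Printing Implicit Defensive.

(* Vertices and edges are drawn from ambient finite types [VT] and [ET], so
   that H, H - e and all hypersubgraphs of H have the same type.  Edges are
   elements of [ET], hence parallel edges (and empty edges) are allowed.  The
   values of [psi] outside [eset] are irrelevant. *)
Record hypergraph (VT ET : finType) := Hypergraph {
  vset : {set VT};
  eset : {set ET};
  psi : ET -> {set VT};
  vset_neq0 : vset != set0;
  psi_sub : forall e, e \in eset -> psi e \subset vset
}.

Section Hypergraphs.
Variables VT ET : finType.
Implicit Types (H : hypergraph VT ET) (u v : VT) (e : ET).

Definition adjacent_via H e u v : bool :=
  [&& u != v, e \in eset H, u \in psi H e & v \in psi H e].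

(* The walk u e_1 v_1 ... e_k v_k is represented by its initial vertex u and
   the sequence p = [:: (e_1, v_1); ...; (e_k, v_k)]. *)
Fixpoint walk H u (p : seq (ET * VT)) : bool :=
  if p is (e, v) :: p' then adjacent_via H e u v && walk H v p'
  else u \in vset H.

Definition joined H u v : Prop :=
  exists p : seq (ET * VT), walk H u p /\ last u (unzip2 p) = v.

Definition connected H : Prop :=
  forall u v, u \in vset H -> v \in vset H -> u != v -> joined H u v.

Definition component H (W : {set VT}) : {set VT} * {set ET} :=
  (W, [set f in eset H | (psi H f != set0) && (psi H f \subset W)]).

Definition components H : {set {set VT} * {set ET}} :=
  [set component H W
    | W in equivalence_partition (fun u v => `[< joined H u v >]) (vset H)].

Definition omega H : nat := #|components H|.

Lemma del_edge_sub H e f : f \in eset H :\ e -> psi H f \subset vset H.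
Proof. by case/setD1P=> _; apply: psi_sub. Qed.

Definition del_edge H e : hypergraph VT ET :=
  Hypergraph (vset_neq0 H) (@del_edge_sub H e).

Definition cut_edge H e : Prop :=
  e \in eset H /\ omega H < omega (del_edge H e).

Definition strong_cut_edge H e : Prop :=
  cut_edge H e /\ omega (del_edge H e) = omega H + #|psi H e| - 1.

Definition weak_cut_edge H e : Prop :=
  cut_edge H e /\ ~ strong_cut_edge H e.

Definition hypersubgraph (H' H : hypergraph VT ET) : Prop :=
  [/\ vset H' \subset vset H, eset H' \subset eset H
    & {in eset H', psi H' =1 psi H}].

Definition separating_vertex H v : Prop :=
  exists H1 H2 : hypergraph VT ET,
    [/\ hypersubgraph H1 H /\ hypersubgraph H2 H,
        connected H1 /\ connected H2,
        eset H1 != set0 /\ eset H2 != set0,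
        eset H1 :&: eset H2 = set0
      & [/\ vset H = vset H1 :|: vset H2, eset H = eset H1 :|: eset H2
          & vset H1 :&: vset H2 = [set v]]].

Definition non_separable H : Prop :=
  [/\ connected H, {in eset H, forall e, psi H e != set0}
    & forall v, v \in vset H -> ~ separating_vertex H v].

End Hypergraphs.

Record graph (T : finType) := Graph {
  gvset : {set T};
  gadj : rel T;
  gadj_sym : symmetric gadj;
  gadj_irr : irreflexive gadj;
  gadj_gvset : forall x y, gadj x y -> x \in gvset
}.

Section Graphs.
Variable T : finType.
Implicit Types (G : graph T) (x : T).

Definition ncomponents G : nat := n_comp (gadj G) (gvset G).

Definition del_vertex_adj G x : rel T :=
  fun y z => [&& y != x, z != x & gadj G y z].

Lemma del_vertex_sym G x : symmetric (del_vertex_adj G x).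
Proof. by move=> y z; rewrite /del_vertex_adj gadj_sym andbCA. Qed.

Lemma del_vertex_irr G x : irreflexive (del_vertex_adj G x).
Proof. by move=> y; rewrite /del_vertex_adj gadj_irr !andbF. Qed.

Lemma del_vertex_gvset G x y z :
  del_vertex_adj G x y z -> y \in gvset G :\ x.
Proof. by case/and3P=> yx _ /gadj_gvset yG; rewrite !inE yx. Qed.

Definition del_vertex G x : graph T :=
  Graph (@del_vertex_sym G x) (@del_vertex_irr G x) (@del_vertex_gvset G x).

Definition cut_vertex G x : Prop :=
  x \in gvset G /\ ncomponents G < ncomponents (del_vertex G x).

End Graphs.

Section IncidenceGraph.
Variables (VT ET : finType) (H : hypergraph VT ET).

Definition incidence_vset : {set VT + ET} :=
  [set inl v | v in vset H] :|: [set inr e | e in eset H].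

Definition incidence_adj : rel (VT + ET) := fun x y =>
  match x, y with
  | inl v, inr e | inr e, inl v => (e \in eset H) && (v \in psi H e)
  | _, _ => false
  end.

Lemma incidence_sym : symmetric incidence_adj.
Proof. by case=> [u|e] [v|f]. Qed.

Lemma incidence_irr : irreflexive incidence_adj.
Proof. by case. Qed.

Lemma incidence_adj_vset x y : incidence_adj x y -> x \in incidence_vset.
Proof.
case: x y => [v|e] [w|f] //= /andP[eE ve]; rewrite inE; apply/orP.
  by left; apply/imset_f/(subsetP (psi_sub eE)).
by right; apply: imset_f.
Qed.

Definition incidence_graph : graph (VT + ET)%type :=
  Graph incidence_sym incidence_irr incidence_adj_vset.

End IncidenceGraph.

(* Main.v *)
Require Import Defs.
From mathcomp Require Import all_boot.
From mathcomp Require Import boolp.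

(** A hypergraph H falls apart at v as soon as its vertices and edges split into
    two parts, each with an edge, whose vertex sets share only v: the
    connectedness of both parts is inherited from H, because a walk ending at v
    cannot leave its part before reaching v.  If a vertex v is a cut vertex of
    G(H), a component of G(H) - v yields such a split.  If e is a cut vertex of
    G(H) and were a strong cut edge, the vertices of e would lie in pairwise
    distinct components of H - e, so the component containing a second edge
    would meet e in a single vertex, at which H again splits. *)

Set Implicit Arguments.
Unset Strict Implicit.
Unset Printing Implicit Defensive.

(** Induction along a path whose target [y] stays fixed while its starting point advances. *)
Lemma connect_ind_left (T : finType) (r : rel T) (P : T -> Prop) (y : T) :
  P y -> (forall x z, r x z -> connect r z y -> P z -> P x) ->
  forall x, connect r x y -> P x.
Proof.
move=> Py step x /connectP[p]; elim: p x => [|z p IHp] x /=; first by move=> _ <-.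
case/andP=> rxz pz eq_y; apply: step (IHp z pz eq_y) => //.
by apply/connectP; exists p.
Qed.

(** * Walks as graph connectivity, and splitting a hypergraph at a vertex *)

Section HypergraphConnectivity.
Variables VT ET : finType.
Implicit Types (H : hypergraph VT ET) (u v w : VT) (e f : ET).

(** Loops are allowed here, unlike in [adjacent_via]; they do not change reachability, which thus
    becomes [connect]. *)
Definition hadj H : rel VT :=
  fun u v => [exists e in eset H, (u \in psi H e) && (v \in psi H e)].

Lemma hadjP H u v :
  reflect (exists e, [/\ e \in eset H, u \in psi H e & v \in psi H e])
          (hadj H u v).
Proof.
apply: (iffP existsP) => [[e /and3P[eH ue ve]]|[e [eH ue ve]]]; exists e => //.
by rewrite eH ue ve.
Qed.

Lemma hadj_sym H : symmetric (hadj H).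
Proof. by move=> u v; apply/hadjP/hadjP => -[e [eH ue ve]]; exists e. Qed.

Lemma joinedP H u v :
  u \in vset H -> reflect (joined H u v) (connect (hadj H) u v).
Proof.
move=> uH; apply: (iffP idP) => [uv | [p []]].
  elim/(@connect_ind_left _ (hadj H)): u / uv uH => [|u w uw _ IHw] uH.
    by exists [::].
  have [->|neq_uw] := eqVneq u w; last first.
    case/hadjP: uw => e [eH ue we].
    have [p [wp lp]] := IHw (subsetP (psi_sub eH) w we).
    by exists ((e, w) :: p); rewrite /= wp /adjacent_via neq_uw eH ue we.
  case/hadjP: uw => e [eH _ we]; exact: IHw (subsetP (psi_sub eH) w we).
elim: p u {uH} => [|[e w] p IHp] u /=; first by move=> _ ->; apply: connect0.
case/andP=> /and4P[_ eH ue we] wp lp.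
apply: connect_trans (IHp _ wp lp); apply: connect1.
by apply/hadjP; exists e.
Qed.

Lemma connected_hadj H u v :
  connected H -> u \in vset H -> v \in vset H -> connect (hadj H) u v.
Proof.
move=> cH uH vH; have [->|uv] := eqVneq u v; first exact: connect0.
by apply/joinedP => //; apply: cH.
Qed.

Lemma hadj_connected H v :
  {in vset H, forall u, connect (hadj H) u v} -> connected H.
Proof.
move=> cHv u w uH wH _; apply/joinedP => //.
apply: (@connect_trans _ _ v); first exact: cHv.
by rewrite (sym_connect_sym (@hadj_sym H)) cHv.
Qed.

(** A path of [H] towards [v] uses only edges of [H1] until it first visits [v], so the induction
    stops there. *)
Lemma part_connected H H1 v :
  connected H -> v \in vset H -> vset H1 \subset vset H ->
  {in eset H1, psi H1 =1 psi H} ->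
  (forall f u, f \in eset H -> u \in psi H f -> u \in vset H1 -> u != v ->
     f \in eset H1) ->
  connected H1.
Proof.
move=> cH vH sub1 psi1 in1; apply: (@hadj_connected _ v) => u uH1.
have := connected_hadj cH (subsetP sub1 u uH1) vH => uv.
elim/(@connect_ind_left _ (hadj H)): u / uv uH1 => [|u w uw _ IHw] uH1.
  exact: connect0.
have [->|neq_uv] := eqVneq u v; first exact: connect0.
case/hadjP: uw => f [fH uf wf]; have fH1 := in1 _ _ fH uf uH1 neq_uv.
have wf1 : w \in psi H1 f by rewrite psi1.
apply: connect_trans (IHw (subsetP (psi_sub fH1) w wf1)); apply: connect1.
by apply/hadjP; exists f; rewrite psi1.
Qed.

Lemma split_separating H v (W : {set VT}) (F : {set ET}) :
  connected H -> v \in W -> W \subset vset H -> F \subset eset H ->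
  F != set0 -> eset H :\: F != set0 ->
  (forall f, f \in F -> psi H f \subset W) ->
  (forall f u, f \in eset H :\: F -> u \in psi H f -> u \in W -> u = v) ->
  separating_vertex H v.
Proof.
move=> cH vW WH FH F0 F'0 psiF psiF'; have vH := subsetP WH v vW.
have W0 : W != set0 by apply/set0Pn; exists v.
(* The second part has the complementary vertices and edges; [v] is put back so that the parts share
   it. *)
set W' := v |: (vset H :\: W).
have W'0 : W' != set0 by apply/set0Pn; exists v; rewrite setU11.
have psiF'W' f : f \in eset H :\: F -> psi H f \subset W'.
  move=> fF'; apply/subsetP=> u uf; rewrite !inE.
  have [uW|uW] := boolP (u \in W); first by rewrite (psiF' f u) ?eqxx.
  have fH : f \in eset H by case/setDP: fF'.
  by rewrite (subsetP (psi_sub fH)) ?orbT.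
have W'H : W' \subset vset H by rewrite subUset sub1set vH subsetDl.
exists (Hypergraph W0 psiF), (Hypergraph W'0 psiF'W'); split=> //=.
- by split; split=> //=; apply: subsetDl.
(* An edge through a vertex other than [v] stays in that vertex's part: outside [F] it meets [W] at
   most in [v], inside [F] it is contained in [W]. *)
- split; apply: (@part_connected H _ v) => //= f u fH uf.
    move=> uW neq_uv; apply: contraNT neq_uv => nfF.
    by rewrite (psiF' f u) // inE nfF.
  rewrite !inE => /predU1P[->|/andP[uW _] _]; first by rewrite eqxx.
  by rewrite fH andbT; apply: contra uW => fF; apply: subsetP (psiF f fF) _ uf.
- by apply/setP=> f; rewrite !inE; case: (f \in F).
split.
- apply/setP=> u; rewrite !inE; have [uW|uW] := boolP (u \in W) => /=.
    exact: (subsetP WH).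
  by have [->|_] := eqVneq u v.
- apply/setP=> f; rewrite !inE; have [fF|//] := boolP (f \in F).
  exact: (subsetP FH).
apply/setP=> u; rewrite !inE; have [->|_] /= := eqVneq u v; first by rewrite vW.
by case: (u \in W).
Qed.

(** * Counting components, deleting an edge, and strong cut edges *)

Definition hclass H u : {set VT} := [set v in vset H | connect (hadj H) u v].

Lemma hclass_eq H u v : u \in vset H -> v \in vset H ->
  (hclass H u == hclass H v) = connect (hadj H) u v.
Proof.
move=> uH vH; apply/eqP/idP => [/setP/(_ v)|uv].
  by rewrite !inE vH connect0.
apply/setP=> w; rewrite !inE.
by rewrite (same_connect (sym_connect_sym (@hadj_sym H)) uv).
Qed.

(** A component records its vertex class, so distinct classes give distinct components. *)
Lemma omegaE H : omega H = #|[set hclass H u | u in vset H]|.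
Proof.
have comp_inj : injective (component H) by move=> W W' [].
rewrite /omega /components (card_imset _ comp_inj).
congr #|pred_of_set _|; apply: eq_in_imset => u uH.
apply/setP=> v; rewrite !inE; congr (_ && _).
exact/asboolP/joinedP.
Qed.

Lemma connected_omega H : connected H -> omega H = 1.
Proof.
move=> cH; have /set0Pn[u uH] := vset_neq0 H.
rewrite omegaE -(cards1 (hclass H u)); congr #|pred_of_set _|.
apply/eqP; rewrite eqEsubset sub1set imset_f // andbT.
apply/subsetP=> _ /imsetP[v vH ->]; rewrite inE.
by rewrite hclass_eq // connected_hadj.
Qed.

Lemma disconnected_omega H u v : u \in vset H -> v \in vset H ->
  ~~ connect (hadj H) u v -> 1 < omega H.
Proof.
move=> uH vH; rewrite -hclass_eq // omegaE => uv.
by apply/card_gt1P; exists (hclass H u), (hclass H v); split=> //; apply: imset_f.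
Qed.

(** A path from [u] to a vertex of [e] survives in [H - e] up to its first use of [e], and that use
    starts at a vertex of [e]. *)
Lemma del_edge_meets H e u : connected H -> e \in eset H -> psi H e != set0 ->
  u \in vset H -> exists2 w, w \in psi H e & connect (hadj (del_edge H e)) u w.
Proof.
move=> cH eH /set0Pn[w we] uH.
have := connected_hadj cH uH (subsetP (psi_sub eH) w we) => uw {uH}.
elim/(@connect_ind_left _ (hadj H)): u / uw => [|u z uz _ [w' w'e zw']].
  by exists w.
case/hadjP: uz => f [fH uf zf]; have [eq_fe|neq_fe] := eqVneq f e.
  by exists u; rewrite -?eq_fe.
exists w' => //; apply: connect_trans zw'; apply: connect1.
by apply/hadjP; exists f; rewrite /= !inE neq_fe.
Qed.

(** Every class of [H - e] meets [e], so sending a vertex of [e] to its class is onto. Strength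
    makes the number of classes [1 + #|psi H e| - 1], hence the map is injective. *)
Lemma strong_cut_edge_disjoint H e u v : connected H -> psi H e != set0 ->
  strong_cut_edge H e -> u \in psi H e -> v \in psi H e ->
  connect (hadj (del_edge H e)) u v -> u = v.
Proof.
move=> cH e0 [[eH _]]; rewrite (connected_omega cH) addKn omegaE => om ue ve.
have eV w : w \in psi H e -> w \in vset H by apply: (subsetP (psi_sub eH)).
have /eqP/imset_injP inj_e :
    #|[set hclass (del_edge H e) w | w in psi H e]| = #|psi H e|.
  rewrite -om; congr #|pred_of_set _|; apply/eqP; rewrite eqEsubset.
  apply/andP; split; apply/subsetP=> _ /imsetP[w wH ->].
    by apply: imset_f; apply: eV.
  have [w' w'e ww'] := del_edge_meets cH eH e0 wH.
  apply/imsetP; exists w' => //; apply/eqP; rewrite hclass_eq //=.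
  exact: eV.
by move=> uv; apply: inj_e => //; apply/eqP; rewrite hclass_eq //= eV.
Qed.

Lemma strong_cut_edge_separating H e f : connected H ->
  {in eset H, forall g, psi H g != set0} -> strong_cut_edge H e ->
  f \in eset H -> f != e -> exists2 v, v \in vset H & separating_vertex H v.
Proof.
move=> cH H0 se fH neq_fe; have eH := se.1.1.
have /set0Pn[u uf] := H0 f fH; have uH := subsetP (psi_sub fH) u uf.
have [v ve uv] := del_edge_meets cH eH (H0 e eH) uH.
have vH := subsetP (psi_sub eH) v ve; exists v => //.
set H' := del_edge H e in uv *.
have clsC : connect_sym (hadj H') := sym_connect_sym (@hadj_sym H').
(* An edge other than [e] that meets the class of [v] lies wholly in it. *)
have cls g y z : g \in eset H -> g != e -> y \in psi H g -> z \in psi H g ->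
    connect (hadj H') v y -> connect (hadj H') v z.
  move=> gH neq_ge yg zg vy; apply: connect_trans vy _; apply: connect1.
  by apply/hadjP; exists g; rewrite /= !inE neq_ge.
have memF g : (g \in [set g in eset H :\ e | psi H g \subset hclass H' v]) =
    [&& g != e, g \in eset H & psi H g \subset hclass H' v].
  by rewrite !inE andbA.
apply: (@split_separating H v (hclass H' v)
  [set g in eset H :\ e | psi H g \subset hclass H' v]) => //.
- by rewrite inE vH connect0.
- by apply/subsetP=> w; rewrite inE => /andP[].
- by apply/subsetP=> g; rewrite memF => /and3P[].
- apply/set0Pn; exists f; rewrite memF neq_fe fH; apply/subsetP=> z zf.
  rewrite inE (subsetP (psi_sub fH)) //=; apply: (cls f u) => //.
  by rewrite clsC.
- by apply/set0Pn; exists e; rewrite inE memF eqxx.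
- by move=> g; rewrite memF => /and3P[].
move=> g w; rewrite inE memF => /andP[nF gH] wg; rewrite inE => /andP[_ vw].
(* Outside the chosen edge set, [e] meets the class only in [v] by strength; any other edge meeting
   the class would have been chosen. *)
have [eq_ge|neq_ge] := eqVneq g e.
  apply/esym/(strong_cut_edge_disjoint cH (H0 e eH) se) => //.
  by rewrite -eq_ge.
case/negP: nF; rewrite neq_ge gH; apply/subsetP=> z zg.
by rewrite inE (subsetP (psi_sub gH)) //=; apply: (cls g w).
Qed.

End HypergraphConnectivity.

(** * Cut vertices of the incidence graph *)

Lemma cut_vertex_disconnects (T : finType) (G : graph T) (x : T) :
  cut_vertex G x ->
  exists a b, [/\ a \in gvset G :\ x, b \in gvset G :\ x
    & ~~ connect (gadj (del_vertex G x)) a b].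
Proof.
move=> [xG lt_n].
have symG := sym_connect_sym (@gadj_sym _ G).
have symG' := sym_connect_sym (@gadj_sym _ (del_vertex G x)).
(* [ncomponents] counts roots lying in [gvset G]; the root of [x] is one, being [x] itself or the
   end of a path's last edge. *)
have n_gt0 : 0 < ncomponents G.
  apply/card_gt0P; exists (root (gadj G) x).
  apply/andP; split; first exact: roots_root.
  have /connectP[p] := connect_root (gadj G) x.
  case/lastP: p => [_ -> //|p y]; rewrite rcons_path last_rcons.
  by case/andP=> _ yG ->; rewrite gadj_sym in yG; apply: gadj_gvset yG.
have /card_gt1P[a [b []]] := leq_ltn_trans n_gt0 lt_n.
move=> /andP[ra aG] /andP[rb bG] neq_ab.
exists a, b; split=> //.
by rewrite -(root_connect symG') (eqP ra) (eqP rb).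
Qed.

Section IncidenceGraph.
Variables (VT ET : finType) (H : hypergraph VT ET).
Implicit Types (u v : VT) (e f : ET).

Lemma inl_incidence_vset v : (inl v \in incidence_vset H) = (v \in vset H).
Proof.
rewrite inE mem_imset; last by move=> ? ? [].
by rewrite [X in _ || X](_ : _ = false) ?orbF //; apply/negP => /imsetP[].
Qed.

Lemma inr_incidence_vset e : (inr e \in incidence_vset H) = (e \in eset H).
Proof.
rewrite inE [X in _ || X]mem_imset; last by move=> ? ? [].
by rewrite [X in X || _](_ : _ = false) //; apply/negP => /imsetP[].
Qed.

Lemma cut_vertex_inl_separating v : connected H ->
  cut_vertex (incidence_graph H) (inl v) -> separating_vertex H v.
Proof.
move=> cH cv; have := cv.1; rewrite [gvset _]/= inl_incidence_vset => vH.
have [a [b [aG bG nab]]] := cut_vertex_disconnects cv.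
set r := gadj _ in nab; have rC : connect_sym r.
  exact/sym_connect_sym/gadj_sym.
have rE u f : u != v -> f \in eset H -> u \in psi H f -> r (inl u) (inr f).
  by move=> uv fH uf; rewrite /r /= /del_vertex_adj /= fH uf !andbT.
(* Both parts need an edge: a vertex other than [v] lies on the first edge of a path of [H] to [v].
   This is applied to [a] and to [b]. *)
have edge_of c : c \in gvset (incidence_graph H) :\ inl v ->
    exists2 f, f \in eset H & connect r c (inr f).
  case: c => [u|f]; rewrite !inE -in_setU -/(incidence_vset H) => /andP[].
    rewrite inl_incidence_vset => neq_uv uH.
    have /connectP[[/= _ eq_vu|w p /= /andP[/hadjP[f [fH uf _]] _ _]]] :=
      connected_hadj cH uH vH.
      by rewrite eq_vu eqxx in neq_uv.
    by exists f => //; apply/connect1/rE.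
  by rewrite inr_incidence_vset => _ fH; exists f.
apply: (@split_separating _ _ H v
  (v |: [set u in vset H | connect r a (inl u)])
  [set f in eset H | connect r a (inr f)]) => //.
- exact: setU11.
- by rewrite subUset sub1set vH; apply/subsetP=> u; rewrite inE => /andP[].
- by apply/subsetP=> f; rewrite inE => /andP[].
- by have [f fH af] := edge_of a aG; apply/set0Pn; exists f; rewrite inE fH.
- have [f fH bf] := edge_of b bG; apply/set0Pn; exists f.
  rewrite !inE fH andbT /=; apply: contra nab => af.
  by apply: connect_trans af _; rewrite rC.
- move=> f; rewrite inE => /andP[fH af]; apply/subsetP=> u uf; rewrite !inE.
  have [//|neq_uv] /= := eqVneq u v; rewrite (subsetP (psi_sub fH)) //=.
  by apply: connect_trans af _; rewrite rC; apply/connect1/rE.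
move=> f u; rewrite !inE => /andP[nF fH] uf.
have [//|neq_uv] /= := eqVneq u v; case/andP=> _ au.
by case/negP: nF; rewrite fH; apply: connect_trans au (connect1 (rE _ _ _ _ _)).
Qed.

(** Two nodes separated in the incidence graph without [e] are traced to two vertices, which [H - e]
    must separate as well. *)
Lemma cut_vertex_inr_cut_edge e : connected H ->
  {in eset H, forall f, psi H f != set0} ->
  cut_vertex (incidence_graph H) (inr e) -> cut_edge H e.
Proof.
move=> cH H0 ce; have := ce.1; rewrite [gvset _]/= inr_incidence_vset => eH.
split=> //; rewrite connected_omega //.
have [a [b [aG bG nab]]] := cut_vertex_disconnects ce.
set r := gadj _ in nab; have rC : connect_sym r.
  exact/sym_connect_sym/gadj_sym.
have rE u f : f != e -> f \in eset H -> u \in psi H f -> r (inl u) (inr f).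
  move=> fe fH uf; rewrite /r /= /del_vertex_adj /= fH uf !andbT.
  by apply: contra fe => /eqP[->].
(* As edges are nonempty, no edge node is isolated. *)
have vertex_of c : c \in gvset (incidence_graph H) :\ inr e ->
    exists2 u, u \in vset H & connect r c (inl u).
  case: c => [u|f]; rewrite !inE -in_setU -/(incidence_vset H) => /andP[].
    by rewrite inl_incidence_vset => _ uH; exists u.
  rewrite inr_incidence_vset => fe fH; have /set0Pn[u uf] := H0 f fH.
  exists u; first exact: (subsetP (psi_sub fH)).
  by rewrite rC; apply/connect1/rE => //; apply: contra fe => /eqP->.
have [u uH au] := vertex_of a aG; have [w wH bw] := vertex_of b bG.
apply: (@disconnected_omega _ _ (del_edge H e) u w) => //.
apply: contra nab => uw; apply: connect_trans au _.
(* Each step of a path in [H - e] via an edge [f] lifts to two steps through the node [inr f]. *)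
elim/(@connect_ind_left _ (hadj (del_edge H e))): u / uw {uH} => [|u z uz _ zb].
  by rewrite rC.
apply: connect_trans zb.
case/hadjP: uz => f [/=]; rewrite !inE => /andP[fe fH] uf zf.
apply: (@connect_trans _ _ (inr f)); first exact/connect1/rE.
by rewrite rC; apply/connect1/rE.
Qed.

End IncidenceGraph.

Theorem theorem3p43 (VT ET : finType) (H : hypergraph VT ET) (x : VT + ET) :
  non_separable H ->
  1 < #|[set e in eset H | 1 < #|psi H e|]| ->
  cut_vertex (incidence_graph H) x ->
  exists e : ET, [/\ x = inr e, e \in eset H & weak_cut_edge H e].
Proof.
move=> [cH H0 nsep] two_edges; case: x => [v cv|e ce].
  have vH : v \in vset H by rewrite -inl_incidence_vset; exact: cv.1.
  by case: (nsep v vH); apply: cut_vertex_inl_separating.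
have cute := cut_vertex_inr_cut_edge cH H0 ce.
exists e; split=> //; first exact: cute.1.
split=> // stronge; case/card_gt1P: two_edges => f [g []].
rewrite !inE => /andP[fH _] /andP[gH _] neq_fg.
(* Of two distinct edges, at least one differs from [e]. *)
have [h hH neq_he] : exists2 h, h \in eset H & h != e.
  have [eq_fe|neq_fe] := eqVneq f e; last by exists f.
  by exists g; rewrite // -eq_fe eq_sym.
have [v vH] := strong_cut_edge_separating cH H0 stronge hH neq_he.
exact: nsep.
Qed.
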